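(* There is an absolute constant $C>0$ such that for all integers $1\le k\le n$ and $T\ge1$ there is an online paging algorithm for $n$ pages and cache size $k$ with per-round running time $\mathrm{poly}(n,\log T)$ whose regret (on the whole interval $\{1,\dots,T\}$) is at most $C\sqrt{kT\log n}$.
   Context: Online paging problem, as a metrical task system. There is a set $P$ of $n$ pages. The states are the caches $C\subseteq P$ with $|C|=k$, with distance $d(C_1,C_2)=|C_1\setminus C_2|$. There is one possible loss function $\ell_i$ for each page $i\in P$ (a request for page $i$): $\ell_i(C)=0$ if $i\in C$ and $\ell_i(C)=2$ if $i\notin C$. At each step $t=1,\dots,T$ the (possibly randomized) algorithm is given the request, i.e. $l_t\in\{\ell_i:i\in P\}$, then chooses a cache $C_t$, and pays $l_t(C_t)$ plus, for $t\ge2$, $d(C_t,C_{t-1})$. The request sequence is fixed in advance (oblivious adversary) and $T$ is known to the algorithm. Regret: the smallest $R(T)$ such that for every request sequence $\mathbb{E}[\sum_{t=1}^Tl_t(C_t)+\sum_{t=2}^Td(C_t,C_{t-1})]\le\min_{C}\sum_{t=1}^Tl_t(C)+R(T)$, the minimum being over all caches $C$. Computation model: arithmetic operations, exponentiation, evaluating the error function, and sampling uniformly from $[0,1]$ each cost $O(1)$. *)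

(* Defs.v *)
From HB Require Import structures.
From mathcomp Require Import all_boot all_order all_algebra.
From mathcomp Require Import all_classical all_reals all_analysis.
Import Order.TTheory GRing.Theory Num.Theory.
Import numFieldNormedType.Exports.

Set Implicit Arguments.
Unset Strict Implicit.
Unset Printing Implicit Defensive.

Local Open Scope classical_set_scope.
Local Open Scope ring_scope.

(******************************************************************************)
(* Algorithms are programs of a real RAM.  Its memory consists of integer     *)
(* arrays and real arrays, named by natural numbers and indexed by nat; a     *)
(* scalar variable is a cell of an array.  Integer values can be used as      *)
(* indices and converted to reals; there is no conversion (such as a floor)   *)
(* from reals to integers other than by comparisons.                          *)
(*                                                                            *)
(* A program is a finite object that mentions neither the parameters n, k, T  *)
(* nor a real constant; it reads n, k, T from memory.  Each of its            *)
(* expressions hence consists of a number of O(1)-cost operations that is     *)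
(* bounded independently of n, k, T, and running time is measured, up to a    *)
(* constant factor that depends on the program only, by the number of         *)
(* applications of step below.                                                *)
(******************************************************************************)

Inductive nexp : Type :=
| NConst of nat
| NGet of nat & nexp
| NAdd of nexp & nexp
| NSub of nexp & nexp
| NMul of nexp & nexp.

Inductive rexp : Type :=
| ROfNat of nexp
| RGet of nat & nexp
| RAdd of rexp & rexp
| RSub of rexp & rexp
| RMul of rexp & rexp
| RDiv of rexp & rexp
| RExp of rexp
| RPow of rexp & rexp
| RErf of rexp.

Inductive test : Type :=
| NLe of nexp & nexp
| RLe of rexp & rexp.

(* [NSet a i e], [RSet a i e] and [Sample a i] write to the cell of index i   *)
(* of the array a.                                                            *)
Inductive cmd : Type :=
| Skip
| NSet of nat & nexp & nexp
| RSet of nat & nexp & rexp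
| Sample of nat & nexp
| Seq of cmd & cmd
| If of test & cmd & cmd
| While of test & cmd.

Definition erf (R : realType) (x : R) : R :=
  2 / Num.sqrt pi *
  (if 0 <= x then \int[@lebesgue_measure R]_(t in `[0, x]) expR (- t ^+ 2)
   else - \int[@lebesgue_measure R]_(t in `[x, 0]) expR (- t ^+ 2)).

(* [used] is the number of samples drawn so far. *)
Record state (R : realType) : Type := State {
  ints : nat -> nat -> nat ;
  reals : nat -> nat -> R ;
  used : nat }.

Definition upd (V : Type) (f : nat -> nat -> V) (a i : nat) (v : V) :=
  fun b j : nat => if (b == a) && (j == i) then v else f b j.

Section Semantics.
Variable R : realType.
Implicit Types s : state R.

(* Subtraction of integers is truncated at 0. *)
Fixpoint neval s (e : nexp) : nat :=
  match e with
  | NConst m => m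
  | NGet a i => ints s a (neval s i)
  | NAdd e1 e2 => (neval s e1 + neval s e2)%N
  | NSub e1 e2 => (neval s e1 - neval s e2)%N
  | NMul e1 e2 => (neval s e1 * neval s e2)%N
  end.

(* x / 0 = 0, and x `^ y = 1 for x < 0. *)
Fixpoint reval s (e : rexp) : R :=
  match e with
  | ROfNat e1 => (neval s e1)%:R
  | RGet a i => reals s a (neval s i)
  | RAdd e1 e2 => reval s e1 + reval s e2
  | RSub e1 e2 => reval s e1 - reval s e2
  | RMul e1 e2 => reval s e1 * reval s e2
  | RDiv e1 e2 => reval s e1 / reval s e2
  | RExp e1 => expR (reval s e1)
  | RPow e1 e2 => powR (reval s e1) (reval s e2)
  | RErf e1 => erf (reval s e1)
  end.

Definition teval s (b : test) : bool :=
  match b with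
  | NLe e1 e2 => (neval s e1 <= neval s e2)%N
  | RLe e1 e2 => reval s e1 <= reval s e2
  end.

(* A configuration is a stack of commands still to be run, and a memory.  The *)
(* tape u holds the successive samples.                                       *)
Definition config : Type := seq cmd * state R.

Definition step (u : nat -> R) (c : config) : config :=
  let s := c.2 in
  match c.1 with
  | [::] => ([::], s)
  | Skip :: K => (K, s)
  | NSet a i e :: K =>
      (K, State (upd (ints s) a (neval s i) (neval s e)) (reals s) (used s))
  | RSet a i e :: K =>
      (K, State (ints s) (upd (reals s) a (neval s i) (reval s e)) (used s))
  | Sample a i :: K =>
      (K, State (ints s) (upd (reals s) a (neval s i) (u (used s)))
            (used s).+1)
  | Seq p q :: K => (p :: q :: K, s)
  | If b p q :: K => ((if teval s b then p else q) :: K, s)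
  | While b p :: K => (if teval s b then p :: While b p :: K else K, s)
  end.

Definition run (u : nat -> R) (tau : nat) (p : cmd) (s : state R) : config :=
  iter tau (step u) ([:: p], s).

End Semantics.

(******************************************************************************)
(* Input and output of a paging program, with pages numbered 0, ..., n - 1:   *)
(* integer array 0 holds n, k, T and the current request in its cells         *)
(* 0, 1, 2, 3; page i is in the cache iff cell i of integer array 1 is        *)
(* nonzero.  All other cells are initially 0.  The whole program is run once  *)
(* in each round, and its memory persists from one round to the next.         *)
(******************************************************************************)

Section PagingProgram.
Variables (R : realType) (p : cmd) (n k T tau : nat).
Variables (u : nat -> R) (r : nat -> 'I_n).

Definition initial_state : state R :=
  State (fun a i => if a == 0%N then nth 0%N [:: n; k; T] i else 0%N)
        (fun _ _ => 0) 0.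

Definition give_request (i : 'I_n) (s : state R) : state R :=
  State (upd (ints s) 0 3 i) (reals s) (used s).

(* Memory after t rounds, each of them interrupted after tau steps if it has  *)
(* not terminated earlier.                                                    *)
Fixpoint state_after (t : nat) : state R :=
  if t is t'.+1 then (run u tau p (give_request (r t) (state_after t'))).2
  else initial_state.

Definition round_terminates (t : nat) : bool :=
  nilp (run u tau p (give_request (r t) (state_after t.-1))).1.

Definition cache_at (t : nat) : {set 'I_n} :=
  [set i : 'I_n | ints (state_after t) 1 i != 0%N]%SET.

End PagingProgram.

(* In every round, whatever the requests and the samples, p terminates within *)
(* tau steps and outputs a cache of size k.                                   *)
Definition paging_algorithm (R : realType) (p : cmd) (n k T tau : nat) : Prop :=
  forall (u : nat -> R) (r : nat -> 'I_n),
    (forall j, 0 <= u j <= 1) ->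
    forall t, (1 <= t <= T)%N ->
      round_terminates p k T tau u r t /\ #|cache_at p k T tau u r t| = k.

Definition loss (n : nat) (i : 'I_n) (C : {set 'I_n}) : nat :=
  if i \in C then 0%N else 2%N.

Definition cache_dist (n : nat) (C1 C2 : {set 'I_n}) : nat := #|C1 :\: C2|.

Definition total_cost (n T : nat) (r : nat -> 'I_n) (C : nat -> {set 'I_n}) :
    nat :=
  (\sum_(1 <= t < T.+1) loss (r t) (C t) +
   \sum_(2 <= t < T.+1) cache_dist (C t) (C t.-1))%N.

(* U is a sequence of independent samples from the uniform law on [0,1]. *)
Record iid_uniform (d : measure_display) (Omega : measurableType d)
    (R : realType) (P : probability Omega R) (U : nat -> {RV P >-> R}) : Prop :=
  IidUniform {
    iid_uniform_range : forall j w, 0 <= U j w <= 1 ;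
    iid_uniform_law : forall j (A : set R), measurable A ->
      P (U j @^-1` A) = uniform_prob (@ltr01 R) A ;
    iid_uniform_indep : forall (J : seq nat) (A : nat -> set R), uniq J ->
      (forall j, measurable (A j)) ->
      P (\bigcap_(j in [set` J]) (U j @^-1` A j)) =
      (\big[mule/1]_(j <- J) P (U j @^-1` A j))%E }.

Section Regret.
Variables (R : realType) (d : measure_display) (Omega : measurableType d).
Variables (P : probability Omega R) (U : nat -> {RV P >-> R}).
Variables (p : cmd) (n k T tau : nat).

Definition expected_cost (r : nat -> 'I_n) : \bar R :=
  ('E_P [fun w : Omega =>
    (total_cost T r (cache_at p k T tau (fun j => U j w) r))%:R])%E.

Definition best_fixed_cost (r : nat -> 'I_n) : \bar R :=
  \big[Order.min/+oo%E]_(C : {set 'I_n} | #|C| == k)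
    ((\sum_(1 <= t < T.+1) loss (r t) C)%N%:R)%:E.

Definition regret : \bar R :=
  ereal_inf [set rho%:E | rho in [set rho : R | forall r : nat -> 'I_n,
    (expected_cost r <= best_fixed_cost r + rho%:E)%E]].

End Regret.

(* Main.v *)
(* The cache at time t consists of the k pages of highest score, the score of *)
(* a page being the number of requests for it up to time t plus a uniform     *)
(* noise in [0, N] drawn once and for all.  As the request is seen before the *)
(* cache is chosen, this follows the perturbed leader including the current   *)
(* step ("be the leader"), so its loss exceeds that of a fixed cache by at    *)
(* most 2 k N for every value of the noise.  A request moves a single score,  *)
(* by 1, so at most one page is fetched, and only if the noise of that page   *)
(* lies in an interval of length 1 determined by the other scores: the        *)
(* expected movement per step is O(1/N).  Take N = sqrt(T/k).                 *)
(* Fubini's theorem is avoided by cutting [0,1]^n into cubes of side at most  *)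
(* 1/N and counting the cubes that meet the event that a page is fetched.     *)

Require Import Defs.
From HB Require Import structures.
From mathcomp Require Import all_boot all_order all_algebra.
From mathcomp Require Import all_classical all_reals all_analysis.
From mathcomp Require Import measurable_realfun.
From mathcomp Require Import zify ring lra.
Import Order.TTheory GRing.Theory Num.Theory.
Import numFieldNormedType.Exports.
Local Open Scope ring_scope.

Set Implicit Arguments.
Unset Strict Implicit.
Unset Printing Implicit Defensive.

(** For each fixed value of the noise, [leader_cost] bounds the cost by the loss of any fixed cache,
    plus the price 2kN of the perturbation, plus the number of times a requested page enters the
    cache. The requests are oblivious, so one draw of the noise can serve all rounds: by linearity
    of expectation only the probability of an entry at each single step matters.

    That probability is O(1/N). Once the noises of the other pages are known up to a small error,
    [topk_window] confines the noise of the requested page to a short window. [card_spread_ffun]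
    turns this into a count of grid cells, and [prob_entry_cells] into the bound 4/N. With N =
    sqrt(T/k) the terms 2kN and 4T/N are both multiples of sqrt(kT), and [expected_cost_bound] gives
    an excess of 6 sqrt(kT). The logarithm enters only at the end: it is bounded below for n >= 2,
    and for n = 1 the cost is zero.

    On the machine side, [round_spec] shows that the memory holds exactly these scores, so that the
    output is [leader], after O(n^2) steps per round. *)

(** * The k highest scores and their stability *)

Section TopK.
Variable R : realType.
Implicit Types (s : nat -> R) (n k : nat).

(** Ties go to the smaller index. This makes the order strict and total, so ranks are distinct and
    [topk] has exactly k elements for all scores, not just almost surely. *)
Definition beats s (j i : nat) : bool := if (j < i)%N then s i <= s j else s i < s j.

Definition rank s n (i : nat) : nat := (\sum_(j < n) beats s j i)%N.

Definition topk s n k : {set 'I_n} := [set i : 'I_n | (rank s n i < k)%N]%SET.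

Lemma beats_ge s j i : beats s j i -> s i <= s j.
Proof. by rewrite /beats; case: ifP => // _ /ltW. Qed.

Lemma beats_gt s j i : s i < s j -> beats s j i.
Proof. by rewrite /beats; case: ifP => // _ /ltW. Qed.

Lemma beats_irr s i : beats s i i = false.
Proof. by rewrite /beats ltnn ltxx. Qed.

Lemma beats_trans s : transitive (beats s).
Proof.
move=> j i l; rewrite /beats.
case: (ltnP i j) => ij; case: (ltnP j l) => jl; case: (ltnP i l) => il;
  move=> h1 h2; first [exfalso; lia | lra].
Qed.

Lemma beats_total s i j : i != j -> beats s i j || beats s j i.
Proof.
rewrite /beats neq_ltn; case: (ltngtP i j) => //= _ _; first by case: leP.
by rewrite orbC; case: leP.
Qed.

Lemma rank_lt s n (j : 'I_n) (i : nat) : beats s j i -> (rank s n j < rank s n i)%N.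
Proof.
move=> ji; rewrite /rank (bigD1 j) //= [X in (_ < X)%N](bigD1 j) //= beats_irr ji.
rewrite add0n add1n ltnS; apply: leq_sum => l _.
by case lj: (beats s l j) => //; rewrite (beats_trans lj ji).
Qed.

Lemma rank_bound s n (i : 'I_n) : (rank s n i < n)%N.
Proof.
rewrite /rank (bigD1 i) //= beats_irr add0n.
have H : (\sum_(j < n | j != i) beats s j i <= \sum_(j < n | j != i) 1)%N.
  by apply: leq_sum => j _; case: beats.
apply: leq_ltn_trans H _; rewrite sum1_card cardC1 card_ord.
by case: n i => [[]|].
Qed.

Lemma card_topk s n k : (k <= n)%N -> #|topk s n k| = k.
Proof.
move=> kn; pose f (i : 'I_n) : 'I_n := Ordinal (rank_bound s i).
have f_inj : injective f.
  move=> i j /(congr1 val) /= ij; apply/eqP; apply: contraT => neq.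
  by case/orP: (beats_total s (neq : val i != val j)) => /rank_lt; rewrite ij ltnn.
have -> : topk s n k = (f @^-1: [set widen_ord kn i | i in 'I_k])%SET.
  apply/setP => i; rewrite !inE; apply/idP/imsetP => [ik|[j _ /(congr1 val) /= ->]] //.
  by exists (Ordinal ik) => //; apply: val_inj.
rewrite on_card_preimset; last exact/onW_bij/injF_bij.
by rewrite card_imset ?card_ord // => i j /(congr1 val) /= /val_inj.
Qed.

Lemma topk_ge s n k (i j : 'I_n) : i \in topk s n k -> j \notin topk s n k -> s j <= s i.
Proof.
rewrite !inE -leqNgt => ik kj; rewrite leNgt; apply/negP => /beats_gt/rank_lt.
by move: ik kj; lia.
Qed.

Lemma topk_max s n k (D : {set 'I_n}) : (k <= n)%N -> #|D| = k ->
  \sum_(i in D) s i <= \sum_(i in topk s n k) s i.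
Proof.
move=> kn Dk; set C := topk s n k.
have Ck : #|C| = k by exact: card_topk.
have CD : #|C :\: D| = #|D :\: C|.
  have := cardsID D C; have := cardsID C D; rewrite finset.setIC; lia.
rewrite (big_setID C) [leRHS](big_setID D) /= finset.setIC lerD2l.
case: (set_0Vmem C) => [C0|[i0 i0C]].
  have /eqP : #|D :\: C| = 0%N by rewrite -CD C0 finset.set0D cards0.
  by rewrite cards_eq0 => /eqP ->; rewrite C0 finset.set0D !big_set0.
(* The lowest score in C separates the two differences, which have equal size: pages of D outside C
   score at most this much, pages of C at least this much. *)
case: (arg_minP (fun i : 'I_n => s i) i0C) => i iC imin.
apply: (@le_trans _ _ (\sum_(j in D :\: C) s i)).
  by apply: ler_sum => j; rewrite inE => /andP[jC _]; apply: topk_ge iC jC.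
rewrite sumr_const -CD -sumr_const; apply: ler_sum => j.
by rewrite inE => /andP[_ jC]; exact: imin.
Qed.

Lemma topk_incr s s' n k (r i : 'I_n) :
  (forall j, s' j = s j + (j == r)%:R) -> i != r ->
  i \in topk s' n k -> i \in topk s n k.
Proof.
move=> s'E ir; rewrite !inE; apply: leq_ltn_trans; apply: leq_sum => j _.
case ji: (beats s j i) => //; suff -> : beats s' j i by [].
have ss' : s j <= s' j by rewrite s'E lerDl ler0n.
have si : s' i = s i by rewrite s'E (negbTE (ir : val i != val r)) addr0.
move: ji; rewrite /beats si; case: ifP => _; lra.
Qed.

Lemma dist_topk_incr s s' n k (r : 'I_n) :
  (forall j, s' j = s j + (j == r)%:R) ->
  (cache_dist (topk s' n k) (topk s n k) <=
     (r \in topk s' n k) && (r \notin topk s n k))%N.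
Proof.
move=> s'E; rewrite /cache_dist.
have sub : topk s' n k :\: topk s n k \subset
    (if (r \in topk s' n k) && (r \notin topk s n k) then [set r] else finset.set0)%SET.
  apply/fintype.subsetP => i; rewrite finset.in_setD => /andP[iN iI].
  have [ir|ir] := eqVneq i r; first by rewrite -ir iI iN inE.
  by move: iN; rewrite (topk_incr s'E ir iI).
by apply: leq_trans (subset_leq_card sub) _; case: ifP => _; rewrite ?cards1 ?cards0.
Qed.

(** Otherwise every page that beats r under b would also beat r under a, since the other pages drop
    by at most delta from b to a and r by more. Then r would rank no worse under b than under a. *)
Lemma topk_window (a b : nat -> R) (delta : R) n k (r : 'I_n) :
  r \in topk a n k -> r \notin topk b n k ->
  (forall j : 'I_n, j != r -> b j <= a j + delta) -> b r <= a r + delta.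
Proof.
rewrite !inE -leqNgt => ra rb ab; rewrite leNgt; apply/negP => lt_ab.
suff : (rank b n r <= rank a n r)%N by move: ra rb; lia.
apply: leq_sum => j _; case jr: (beats b j r) => //.
have [Ejr|j_r] := eqVneq j r; first by rewrite Ejr beats_irr in jr.
rewrite beats_gt //; have := ab j j_r; have := beats_ge jr; lra.
Qed.

End TopK.

(** * Cost of following the perturbed leader, for a fixed noise *)

Section Leader.
Variables (R : realType) (N : R) (n k : nat).
Hypotheses (N_ge0 : 0 <= N) (kn : (k <= n)%N).
Variables (u : nat -> R) (r : nat -> 'I_n).
Hypothesis u01 : forall j, 0 <= u j <= 1.

Definition score (t i : nat) : R :=
  N * u i + (\sum_(1 <= s < t.+1) (r s == i :> nat))%:R.

Definition leader (t : nat) : {set 'I_n} := topk (score t) n k.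

Lemma score0 i : score 0 i = N * u i.
Proof. by rewrite /score big_geq // addr0. Qed.

Lemma scoreS t i : score t.+1 i = score t i + (i == r t.+1)%:R.
Proof. by rewrite /score big_nat_recr //= natrD addrA [_ == i]eq_sym. Qed.

Definition enters (t : nat) : bool := (r t \in leader t) && (r t \notin leader t.-1).

Lemma sum_scoreS t (D : {set 'I_n}) :
  \sum_(i in D) score t.+1 i = \sum_(i in D) score t i + (r t.+1 \in D)%:R.
Proof.
under eq_bigr do rewrite scoreS; rewrite big_split /=; congr (_ + _).
have [rD|rD] := boolP (r t.+1 \in D).
  rewrite (bigD1 (r t.+1)) //= eqxx big1 ?addr0 // => i /andP[_ ir].
  by rewrite (negbTE (ir : val i != val (r t.+1))).
rewrite big1 // => i iD; case: eqP => // /val_inj ir.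
by move: rD; rewrite -ir iD.
Qed.

(** Induction on t: D is replaced by the current leader, which has the larger total; the last
    request is split off, and the induction hypothesis is applied to that leader as a competitor at
    time t. The noise is paid once, at t = 0. *)
Lemma be_the_leader t (D : {set 'I_n}) : #|D| = k ->
  \sum_(i in D) score t i <=
  (\sum_(1 <= s < t.+1) (r s \in leader s))%:R + k%:R * N.
Proof.
elim: t D => [|t IH] D Dk.
  rewrite big_geq // add0r -Dk mulr_natl -sumr_const; apply: ler_sum => i _.
  by rewrite score0 ler_piMr //; case/andP: (u01 i).
apply: le_trans (topk_max (score t.+1) kn Dk) _.
rewrite sum_scoreS big_nat_recr //= natrD addrAC lerD2r.
by apply: IH; exact: card_topk.
Qed.

Lemma sum_score_ge t (D : {set 'I_n}) :
  (\sum_(1 <= s < t.+1) (r s \in D))%:R <= \sum_(i in D) score t i.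
Proof.
elim: t => [|t IH].
  rewrite big_geq //; apply: sumr_ge0 => i _; rewrite score0.
  by rewrite mulr_ge0 //; case/andP: (u01 i).
by rewrite sum_scoreS big_nat_recr //= natrD lerD2r.
Qed.

Lemma sum_loss t (C : nat -> {set 'I_n}) :
  (\sum_(1 <= s < t.+1) loss (r s) (C s))%:R =
  2 * t%:R - 2 * (\sum_(1 <= s < t.+1) (r s \in C s))%:R :> R.
Proof.
elim: t => [|t IH]; first by rewrite !big_geq // mulr0 subrr.
rewrite big_nat_recr //= natrD IH [in RHS]big_nat_recr //= natrD /loss -(natr1 t).
case: ifP => _; rewrite ?mulr0n ?mulr1n; ring.
Qed.

Lemma leader_cost T (D : {set 'I_n}) : #|D| = k ->
  (total_cost T r leader)%:R <=
  (\sum_(1 <= t < T.+1) loss (r t) D)%:R + 2 * k%:R * N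
  + \sum_(2 <= t < T.+1) (enters t)%:R.
Proof.
move=> Dk; rewrite /total_cost natrD; apply: lerD; last first.
  rewrite natr_sum big_nat [leRHS]big_nat; apply: ler_sum => t /andP[t2 _].
  rewrite ler_nat; case: t t2 => [//|t] _.
  by apply: dist_topk_incr => j; exact: scoreS.
rewrite (sum_loss T leader) (sum_loss T (fun=> D)).
have := be_the_leader T Dk; have := sum_score_ge T D; lra.
Qed.

End Leader.

(** * A total-correctness calculus with step counts *)

Section TotalCorrectness.
Variables (R : realType) (u : nat -> R).
Implicit Types (s : state R) (p q : cmd) (Q : state R -> Prop).

(** The quantification over the remaining stack K is what lets commands be composed. *)
Definition ends_within p (m : nat) Q s : Prop :=
  exists m' s', [/\ (m' <= m)%N, Q s' &
    forall K, iter m' (step u) (p :: K, s) = (K, s')].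

Lemma ends_within_weaken p m1 m2 (Q1 Q2 : state R -> Prop) s :
  (m1 <= m2)%N -> (forall s', Q1 s' -> Q2 s') ->
  ends_within p m1 Q1 s -> ends_within p m2 Q2 s.
Proof.
move=> m12 Q12 [m' [s' [m'm Qs' run_p]]]; exists m', s'.
by split => //; [exact: leq_trans m12 | exact: Q12].
Qed.

Lemma ends_within_skip Q s : Q s -> ends_within Skip 1 Q s.
Proof. by move=> Qs; exists 1%N, s. Qed.

Lemma ends_within_nset a i e Q s :
  Q (State (upd (ints s) a (neval s i) (neval s e)) (reals s) (used s)) ->
  ends_within (NSet a i e) 1 Q s.
Proof. by move=> Qs; eexists 1%N, _; split; [|exact: Qs|]. Qed.

Lemma ends_within_rset a i e Q s :
  Q (State (ints s) (upd (reals s) a (neval s i) (reval s e)) (used s)) ->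
  ends_within (RSet a i e) 1 Q s.
Proof. by move=> Qs; eexists 1%N, _; split; [|exact: Qs|]. Qed.

Lemma ends_within_sample a i Q s :
  Q (State (ints s) (upd (reals s) a (neval s i) (u (used s))) (used s).+1) ->
  ends_within (Sample a i) 1 Q s.
Proof. by move=> Qs; eexists 1%N, _; split; [|exact: Qs|]. Qed.

Lemma ends_within_seq p q m1 m2 Q s :
  ends_within p m1 (ends_within q m2 Q) s ->
  ends_within (Seq p q) (m2 + m1).+1 Q s.
Proof.
move=> [k1 [s1 [k1m [k2 [s2 [k2m Qs2 run_q]]] run_p]]].
exists (k2 + k1).+1, s2; split; [by rewrite ltnS leq_add | by [] | move=> K].
by rewrite iterSr iterD run_p run_q.
Qed.

Lemma ends_within_if b p q m Q s :
  ends_within (if teval s b then p else q) m Q s -> ends_within (If b p q) m.+1 Q s.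
Proof.
move=> [m' [s' [m'm Qs' run_pq]]]; exists m'.+1, s'; split => // K.
by rewrite iterSr; exact: run_pq.
Qed.

Definition for_loop (a : nat) (p : cmd) : cmd :=
  Seq (NSet a (NConst 0) (NConst 0))
    (While (NLe (NAdd (NGet a (NConst 0)) (NConst 1)) (NGet 0 (NConst 0)))
      (Seq p (NSet a (NConst 0) (NAdd (NGet a (NConst 0)) (NConst 1))))).

Definition set_int s a v : state R :=
  State (upd (ints s) a 0 v) (reals s) (used s).

Lemma ends_within_while n a p m (Inv : nat -> state R -> Prop) i s :
  (forall j s', Inv j s' -> ints s' 0 0 = n /\ ints s' a 0 = j) ->
  (forall j s', (j < n)%N -> Inv j s' ->
     ends_within p m
       (fun s2 => ints s2 a 0 = j /\ Inv j.+1 (set_int s2 a j.+1)) s') ->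
  Inv i s -> (i <= n)%N ->
  ends_within (While (NLe (NAdd (NGet a (NConst 0)) (NConst 1)) (NGet 0 (NConst 0)))
      (Seq p (NSet a (NConst 0) (NAdd (NGet a (NConst 0)) (NConst 1)))))
    ((n - i) * (m + 3)).+1 (Inv n) s.
Proof.
move=> InvE body; move Ed: (n - i)%N => d; elim: d i s Ed => [|d IH] i s Ed Is le_in.
  have Ein : i = n by apply/eqP; rewrite eqn_leq le_in -subn_eq0 Ed.
  exists 1%N, s; split => // [|K]; first by rewrite -{1}Ein.
  by have [n_s a_s] := InvE _ _ Is; rewrite /= /step /= n_s a_s Ein addn1 ltnn.
have lt_in : (i < n)%N by rewrite -subn_gt0 Ed.
have [m1 [s1 [m1m [a_s1 Is1] run_p]]] := body _ _ lt_in Is.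
have [m2 [s2 [m2m Is2 run_w]]] : ends_within _ _ _ _ :=
  IH i.+1 _ ltac:(by rewrite subnS Ed) Is1 lt_in.
(* One iteration costs the test, the unfolding of [Seq], the body and the increment, hence m + 3. *)
exists ((m2 + 1) + m1).+2, s2; split => // [|K]; first by rewrite mulSn; lia.
have [n_s a_s] := InvE _ _ Is.
rewrite 2!iterSr [in X in iter _ _ X]/step /= n_s a_s (addn1 i) lt_in /= iterD run_p.
rewrite iterD /= [in X in iter _ _ X]/step /= a_s1 addn1; exact: run_w.
Qed.

Lemma ends_within_for n a p m (Inv : nat -> state R -> Prop) s :
  (forall j s', Inv j s' -> ints s' 0 0 = n /\ ints s' a 0 = j) ->
  (forall j s', (j < n)%N -> Inv j s' ->
     ends_within p m
       (fun s2 => ints s2 a 0 = j /\ Inv j.+1 (set_int s2 a j.+1)) s') ->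
  Inv 0%N (set_int s a 0) ->
  ends_within (for_loop a p) (n * (m + 3) + 3) (Inv n) s.
Proof.
move=> InvE body I0.
apply: (@ends_within_weaken _ ((n - 0) * (m + 3)).+1.+1.+1 _ (Inv n)) => //.
  by rewrite subn0; lia.
rewrite -[X in X.+1]addn1; apply: ends_within_seq.
by apply: ends_within_nset; apply: ends_within_while InvE body I0 _.
Qed.

Lemma ends_within_run p m Q s : ends_within p m Q s ->
  nilp (run u m p s).1 /\ Q (run u m p s).2.
Proof.
move=> [m' [s' [m'm Qs' run_p]]].
have halt j : iter j (step u) ([::], s') = ([::], s').
  by elim: j => // j IH; rewrite iterS IH.
by rewrite /run -(subnK m'm) iterD run_p halt.
Qed.

End TotalCorrectness.

(* Cell 0 of integer array 2 is a flag telling that the noise has been drawn, *)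
(* those of arrays 3 and 4 are loop counters, and that of array 5 is the rank *)
(* being computed; real array 0 holds the scores.                             *)
Definition var (a : nat) : nexp := NGet a (NConst 0).
Definition n_exp : nexp := NGet 0 (NConst 0).
Definition k_exp : nexp := NGet 0 (NConst 1).
Definition T_exp : nexp := NGet 0 (NConst 2).
Definition request : nexp := NGet 0 (NConst 3).

Definition noise_exp : rexp :=
  RPow (RDiv (ROfNat T_exp) (ROfNat k_exp)) (RDiv (ROfNat (NConst 1)) (ROfNat (NConst 2))).

Definition draw_noise : cmd :=
  If (NLe (NConst 1) (var 2)) Skip
    (Seq (NSet 2 (NConst 0) (NConst 1))
      (for_loop 3 (Seq (Sample 0 (var 3))
        (RSet 0 (var 3) (RMul noise_exp (RGet 0 (var 3))))))).

Definition count_request : cmd :=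
  RSet 0 request (RAdd (RGet 0 request) (ROfNat (NConst 1))).

Definition compare_scores : cmd :=
  let incr := NSet 5 (NConst 0) (NAdd (var 5) (NConst 1)) in
  If (NLe (NAdd (var 4) (NConst 1)) (var 3))
    (If (RLe (RGet 0 (var 3)) (RGet 0 (var 4))) incr Skip)
    (If (RLe (RGet 0 (var 4)) (RGet 0 (var 3))) Skip incr).

(* The truncated difference k - rank is nonzero iff the rank is less than k.  *)
Definition update_cache : cmd :=
  for_loop 3 (Seq (NSet 5 (NConst 0) (NConst 0))
    (Seq (for_loop 4 compare_scores) (NSet 1 (var 3) (NSub k_exp (var 5))))).

Definition paging_program : cmd :=
  Seq draw_noise (Seq count_request update_cache).

(** * One round of the program: result and running time *)

Section Correctness.
Variables (R : realType) (n k T : nat) (u : nat -> R).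
Implicit Types s : state R.

Definition noise_scale : R := (T%:R / k%:R) `^ (1%:R / 2%:R).

Definition input_ok s : Prop :=
  [/\ ints s 0 0 = n, ints s 0 1 = k & ints s 0 2 = T].

Definition scores_are (f : nat -> R) s : Prop :=
  forall i, (i < n)%N -> reals s 0 i = f i.

Definition noise_drawn (f : nat -> R) (req : nat) s : Prop :=
  [/\ input_ok s, ints s 0 3 = req, ints s 2 0 = 1%N & scores_are f s].

Lemma upd_same V (f : nat -> nat -> V) a i v : upd f a i v a i = v.
Proof. by rewrite /upd !eqxx. Qed.

Lemma upd_neq V (f : nat -> nat -> V) a i v b j :
  (b == a) && (j == i) = false -> upd f a i v b j = f b j.
Proof. by rewrite /upd => ->. Qed.

Lemma draw_noise_first (req : nat) s :
  input_ok s -> ints s 0 3 = req -> ints s 2 0 = 0%N -> used s = 0%N ->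
  ends_within u draw_noise (n * 6 + 6) (noise_drawn (fun i => noise_scale * u i) req) s.
Proof.
move=> [n_s k_s T_s] req_s flag_s used_s.
rewrite addnS; apply: ends_within_if; rewrite /= flag_s /=.
have -> : (n * 6 + 5 = (n * (3 + 3) + 3 + 1).+1)%N by lia.
apply: ends_within_seq; apply: ends_within_nset.
pose Inv j s' := [/\ input_ok s' /\ ints s' 0 3 = req, ints s' 2 0 = 1%N,
  ints s' 3 0 = j, used s' = j &
  forall i, (i < j)%N -> reals s' 0 i = noise_scale * u i].
apply: (@ends_within_weaken _ _ _ (n * (3 + 3) + 3)%N _ (Inv n)) => //.
  by move=> s' [[? ?] ? _ _ ?].
apply: ends_within_for => [j s' [[[]]]|j s' ltj|] //.
move=> [[[n_s' k_s' T_s'] req_s'] flag_s' cnt_s' used_s' reals_s'].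
apply: (ends_within_seq (m1 := 1) (m2 := 1)); apply: ends_within_sample.
apply: ends_within_rset => /=.
split => //; split => //=; first by rewrite used_s'.
move=> i; rewrite ltnS leq_eqVlt => /predU1P[->|ij].
  by rewrite cnt_s' T_s' k_s' !upd_same used_s'.
by rewrite cnt_s' /upd /= (ltn_eqF ij); exact: reals_s'.
Qed.

Lemma draw_noise_later f req s :
  noise_drawn f req s -> ends_within u draw_noise (n * 6 + 6) (noise_drawn f req) s.
Proof.
move=> [in_s req_s flag_s sc_s].
apply: (@ends_within_weaken _ _ _ 2 _ (noise_drawn f req)) => //; first by lia.
by apply: ends_within_if; rewrite /= flag_s; apply: ends_within_skip.
Qed.

Lemma count_request_spec f (req : nat) s : (req < n)%N ->
  noise_drawn f req s ->
  ends_within u count_request 1 (noise_drawn (fun i => f i + (i == req)%:R) req) s.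
Proof.
move=> req_n [in_s req_s flag_s sc_s]; apply: ends_within_rset; split => //= i i_n.
rewrite /= req_s; have [->|i_req] := eqVneq i req; first by rewrite upd_same sc_s.
by rewrite upd_neq ?sc_s ?addr0 // (negbTE i_req).
Qed.

Definition ranks_below (f : nat -> R) (m : nat) s : Prop :=
  forall i, (i < m)%N -> ints s 1 i = (k - rank f n i)%N.

Lemma compare_scores_loop (f : nat -> R) (req i : nat) s : (i < n)%N ->
  noise_drawn f req s -> ints s 3 0 = i -> ints s 5 0 = 0%N -> ranks_below f i s ->
  ends_within u (for_loop 4 compare_scores) (n * 6 + 3)
    (fun s' => [/\ noise_drawn f req s', ints s' 3 0 = i, ints s' 5 0 = rank f n i &
                  ranks_below f i s']) s.
Proof.
move=> i_n nd_s i_s r_s rb_s.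
pose Inv j s' := [/\ noise_drawn f req s' /\ ints s' 3 0 = i, ints s' 4 0 = j,
  ints s' 5 0 = (\sum_(l < j) beats f l i)%N & ranks_below f i s'].
apply: (@ends_within_weaken _ _ _ (n * (3 + 3) + 3)%N _ (Inv n)) => //.
  by move=> s' [[? ?] ? ? ?].
apply: ends_within_for => [j s' [[[[? _ _]] _ _ _] _] //|j s' j_n|]; last first.
  by split => //=; rewrite big_ord0.
move=> [[[in_s' req_s' flag_s' sc_s'] i_s'] j_s' r_s' rb_s'].
apply: ends_within_if; rewrite /= i_s' j_s' addn1.
(* Skipping and adding 1 leave different memories, but both agree with adding the truth value of
   [beats]; the disjunction covers the two outcomes at once. *)
apply: (@ends_within_weaken _ _ _ 2 _
  (fun s2 => s2 = set_int s' 5 (\sum_(l < j) beats f l i + beats f j i) \/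
     (~~ beats f j i /\ s2 = s'))) => //.
  move=> s2 s2E.
  have {s2E}[b2 [s2E r_s2]] : exists b, s2 = (if b then
       set_int s' 5 (\sum_(l < j) beats f l i + beats f j i) else s') /\
       ints s2 5 0 = (\sum_(l < j.+1) beats f l i)%N.
    rewrite big_ord_recr /=; case: s2E => [->|[nb ->]]; first by exists true.
    by exists false; rewrite r_s' (negbTE nb) addn0.
  by split; [|split => //=]; rewrite s2E; case: b2 {s2E}.
rewrite /beats; case: ifP => _.
  apply: ends_within_if; rewrite /= i_s' j_s' !sc_s' //; case: ifP => _.
    by apply: ends_within_nset; left; rewrite /= r_s'.
  by apply: ends_within_skip; right.
apply: ends_within_if; rewrite /= i_s' j_s' !sc_s' // ltNge; case: ifP => _.
  by apply: ends_within_skip; right.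
by apply: ends_within_nset; left; rewrite /= r_s'.
Qed.

Lemma update_cache_spec f (req : nat) s :
  noise_drawn f req s ->
  ends_within u update_cache (n * (n * 6 + 10) + 3)
    (fun s' => noise_drawn f req s' /\ ranks_below f n s') s.
Proof.
move=> nd_s.
pose Inv j s' := [/\ noise_drawn f req s', ints s' 3 0 = j & ranks_below f j s'].
apply: (@ends_within_weaken _ _ _ (n * ((n * 6 + 7) + 3) + 3)%N _ (Inv n)) => //.
- by rewrite -addnA.
- by move=> s' [].
apply: ends_within_for => [j s' [[[? _ _] _ _ _]] //|j s' j_n|]; last by split.
move=> [nd_s' j_s' rb_s'].
have -> : (n * 6 + 7 = (1 + (n * 6 + 3)).+1 + 1 + 1)%N by lia.
rewrite [X in ends_within _ _ X]addn1.
apply: ends_within_seq; apply: ends_within_nset; apply: ends_within_seq.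
apply: ends_within_weaken (compare_scores_loop (f := f) (req := req) j_n _ _ _ _) => //=.
move=> s2 [[in_s2 req_s2 flag_s2 sc_s2] j_s2 r_s2 rb_s2].
have [n_s2 k_s2 T_s2] := in_s2.
apply: ends_within_nset => /=; rewrite j_s2 r_s2; split => //; split => //= i.
rewrite ltnS leq_eqVlt k_s2 => /predU1P[->|ij]; first exact: upd_same.
rewrite /= upd_neq // upd_neq; last by apply/negbTE/negP => /andP[_ /eqP E]; rewrite E ltnn in ij.
exact: rb_s2.
Qed.

Definition round_time : nat := (n * (n * 6 + 10) + n * 6 + 20)%N.

Lemma paging_program_spec f (req : nat) s : (req < n)%N ->
  ends_within u draw_noise (n * 6 + 6) (noise_drawn f req) s ->
  ends_within u paging_program round_time
    (fun s' => noise_drawn (fun i => f i + (i == req)%:R) req s' /\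
      ranks_below (fun i => f i + (i == req)%:R) n s') s.
Proof.
move=> req_n draw.
apply: (@ends_within_weaken _ _ _ (((n * (n * 6 + 10) + 3) + 1).+1 + (n * 6 + 6)).+1) => //.
- by rewrite /round_time; lia.
- by move=> s' Q; exact: Q.
apply: ends_within_seq; apply: ends_within_weaken draw => // s1 nd1.
apply: ends_within_seq; apply: ends_within_weaken (count_request_spec req_n nd1) => // s2.
exact: update_cache_spec.
Qed.

End Correctness.

(** * The output of the program is the perturbed leader *)

Section Rounds.
Variables (R : realType) (n k T : nat) (u : nat -> R) (r : nat -> 'I_n).
Local Notation N := (noise_scale R k T).
Local Notation sc := (score N u r).
Local Notation state_at := (state_after paging_program k T (round_time n) u r).

Lemma rank_ext (f g : nat -> R) (i : 'I_n) : (forall j, f j = g j) -> rank f n i = rank g n i.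
Proof. by move=> fg; apply: eq_bigr => j _; rewrite /beats !fg. Qed.

(** The invariant across rounds. The first round starts with the flag unset and draws sample i for
    page i; later rounds find the flag set and keep the scores, so the noise is never redrawn. *)
Lemma round_spec t :
  let s := give_request (r t.+1) (state_at t) in
  [/\ nilp (run u (round_time n) paging_program s).1,
     input_ok n k T (state_at t.+1) /\ ints (state_at t.+1) 2 0 = 1%N,
     scores_are n (sc t.+1) (state_at t.+1) &
     ranks_below n k (sc t.+1) n (state_at t.+1)].
Proof.
elim: t => [|t [_ [[n_s k_s T_s] flag_s] sc_s _]] s.
  have /(paging_program_spec (ltn_ord (r 1)))/ends_within_run :
      ends_within u draw_noise (n * 6 + 6) (noise_drawn n k T (sc 0) (r 1)) s.
    apply: ends_within_weaken (draw_noise_first (n := n) (k := k) (T := T) u _ _ _ _) => //.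
    by move=> s' [? ? ? nd]; split => // i /nd ->; rewrite score0.
  case=> end_s [[in_s _ flag_s sc_s] rb_s].
  split => // [i i_n|i i_n]; first by rewrite scoreS; exact: sc_s.
  rewrite (rank_ext (Ordinal i_n) (g := fun j => sc 0 j + (j == r 1)%:R)); first exact: rb_s.
  by move=> j; rewrite scoreS.
have /(paging_program_spec (ltn_ord (r t.+2)))/ends_within_run :
    ends_within u draw_noise (n * 6 + 6) (noise_drawn n k T (sc t.+1) (r t.+2)) s.
  by apply: draw_noise_later; split.
case=> end_s [[in_s _ flag_s' sc_s'] rb_s].
split => // [i i_n|i i_n]; first by rewrite scoreS; exact: sc_s'.
rewrite (rank_ext (Ordinal i_n) (g := fun j => sc t.+1 j + (j == r t.+2)%:R)); first exact: rb_s.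
by move=> j; rewrite scoreS.
Qed.

Lemma cache_at_leader t : (0 < t)%N ->
  cache_at paging_program k T (round_time n) u r t = leader N k u r t.
Proof.
case: t => // t _; have [_ _ _ rb] := round_spec t.
by apply/setP => i; rewrite !inE rb // -lt0n subn_gt0.
Qed.

Lemma round_terminates_within t : (0 < t)%N ->
  round_terminates paging_program k T (round_time n) u r t.
Proof. by case: t => // t _; have [] := round_spec t. Qed.

End Rounds.

(** * Counting the grid cells in which an entry can happen *)

Lemma card_interval_ord (M d : nat) (A : {set 'I_M}) :
  (forall a b, a \in A -> b \in A -> (b <= a + d)%N) -> (#|A| <= d.+1)%N.
Proof.
move=> spread; case: (set_0Vmem A) => [->|[a0 a0A]]; first by rewrite cards0.
case: (arg_minP (fun i : 'I_M => i : nat) a0A) => a aA amin.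
pose h (b : 'I_M) : 'I_d.+1 := inord (b - a).
have h_inj : {in A &, injective h}.
  move=> b c bA cA /(congr1 (@nat_of_ord _)).
  have := spread _ _ aA bA; have := spread _ _ aA cA.
  have := amin _ bA; have := amin _ cA; rewrite !leEnat => ? ? ? ?.
  by rewrite /= !inordK; try lia; move=> ?; apply: val_inj => /=; lia.
by rewrite -(card_in_imset h_inj) -[leqRHS]card_ord max_card.
Qed.

(** Discrete stand-in for integrating out one coordinate: erasing coordinate r groups S into lines,
    each line meets S in at most d + 1 cells, and there are at most (M+1)^(n-1) lines. *)
Lemma card_spread_ffun (n M d : nat) (r : 'I_n) (S : {set {ffun 'I_n -> 'I_M.+1}}) :
  (forall v v', v \in S -> v' \in S -> (forall j, j != r -> v j = v' j) ->
     (v' r <= v r + d)%N) ->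
  (#|S| <= d.+1 * M.+1 ^ n.-1)%N.
Proof.
move=> spread; pose f (v : {ffun 'I_n -> 'I_M.+1}) : {ffun 'I_n -> 'I_M.+1} :=
  [ffun j => if j == r then ord0 else v j].
have fE v v' : f v = f v' -> forall j, j != r -> v j = v' j.
  by move=> /ffunP + j jr => /(_ j); rewrite !ffunE (negbTE jr).
rewrite -sum1_card (partition_big_imset f) /=.
have fibre w : (\sum_(v in S | f v == w) 1 <= d.+1)%N.
  set F := [set v in S | f v == w]%SET.
  have -> : (\sum_(v in S | f v == w) 1 = #|F|)%N.
    by rewrite -sum1_card; apply: eq_bigl => v; rewrite inE.
  have r_inj : {in F &, injective (fun v : {ffun 'I_n -> 'I_M.+1} => v r)}.
    move=> v v'; rewrite !inE => /andP[_ /eqP <-] /andP[_ /eqP /fE vv'] vr.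
    by apply/ffunP => j; have [->|/vv'] := eqVneq j r.
  rewrite -(card_in_imset r_inj); apply: card_interval_ord => a b.
  move=> /imsetP[v + ->] /imsetP[v' + ->]; rewrite !inE.
  move=> /andP[vS /eqP <-] /andP[v'S /eqP v'v]; apply: spread => // j jr.
  by rewrite (fE _ _ v'v).
apply: (@leq_trans (\sum_(w in [set f v | v in S]%SET) d.+1)).
  by apply: leq_sum => w _; exact: fibre.
rewrite sum_nat_const mulnC leq_mul2l /=.
have <- : #|pffun_on (ord0 : 'I_M.+1) (predC1 r) predT| = (M.+1 ^ n.-1)%N.
  by rewrite card_pffun_on cardC1 !card_ord.
apply/subset_leq_card/fintype.subsetP => _ /imsetP[v _ ->].
apply/pffun_onP; split => //; apply/fintype.subsetP => j.
by rewrite !inE ffunE; case: (eqVneq j r).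
Qed.

Lemma grid_cell (R : realType) (M : nat) (x : R) : 0 <= x <= 1 ->
  exists c : 'I_M.+1, c%:R / M.+1%:R <= x <= c.+1%:R / M.+1%:R.
Proof.
move=> /andP[x0 x1]; have M0 : 0 < M.+1%:R :> R by rewrite ltr0n.
have [lt1|ge1] := ltP x 1.
  have xM : 0 <= x * M.+1%:R by rewrite mulr_ge0 ?ler0n.
  have cM : (Num.truncn (x * M.+1%:R) < M.+1)%N.
    by rewrite truncn_lt_nat // gtr_pMl.
  exists (Ordinal cM) => /=; rewrite ler_pdivrMr // ler_pdivlMr //.
  by rewrite truncn_le xM ltW // truncnS_gt.
(* The right endpoint goes to the last cell. Cells are closed and overlap on their faces, which is
   harmless for an upper bound. *)
exists ord_max => /=; have -> : x = 1 by lra.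
by rewrite divff ?gt_eqF // lexx andbT ler_pdivrMr // mul1r ler_nat.
Qed.

Lemma grid_shift (R : realType) (N m a b x x' : R) : 0 < N -> 0 < m ->
  b / m <= x' -> x <= (a + 1) / m -> N * x' <= N * x + 1 + N / m ->
  N * b <= N * a + 2 * N + m.
Proof.
move=> N0 m0; rewrite ler_pdivrMr // ler_pdivlMr // => bx' xa win.
have {win} : N * x' * m <= N * x * m + m + N.
  by have := ler_wpM2r (ltW m0) win; rewrite !mulrDl divfK ?gt_eqF // mul1r.
have := ler_wpM2l (ltW N0) bx'; have := ler_wpM2l (ltW N0) xa; lra.
Qed.

Section Stability.
Variables (R : realType) (N : R) (n k M : nat) (r : nat -> 'I_n).
Hypothesis N_gt0 : 0 < N.
Implicit Types (u : nat -> R) (v : {ffun 'I_n -> 'I_M.+1}).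

Definition in_cell v u : Prop :=
  forall j : 'I_n, (v j)%:R / M.+1%:R <= u j <= (v j).+1%:R / M.+1%:R.

Definition entry_cells (t : nat) : {set {ffun 'I_n -> 'I_M.+1}} :=
  [set v | `[< exists u, in_cell v u /\ enters N k u r t >]]%SET.

(* The other coordinates, known up to 1/M, fix the score needed to enter the  *)
(* cache up to N/M; so u_r ranges over an interval of length 1/N + 1/M.       *)
Lemma entry_cells_spread t v v' : (0 < t)%N ->
  v \in entry_cells t -> v' \in entry_cells t ->
  (forall j, j != r t -> v j = v' j) ->
  (v' (r t) <= v (r t) + Num.truncn (2 + M.+1%:R / N))%N.
Proof.
case: t => // t _; rewrite !inE => -[u [vu /andP[u_in _]]].
move=> [u' [vu' /andP[_ u'_out]]] vv'.
have M0 : 0 < M.+1%:R :> R by rewrite ltr0n.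
(* The window lemma compares the scores of u after the request with those of u' before it. The
   request accounts for the extra 1, the grid for N/(M+1). *)
have := topk_window (delta := N / M.+1%:R) u_in u'_out.
rewrite /= !scoreS eqxx => win.
have {win} : score N u' r t (r t.+1) <= score N u r t (r t.+1) + 1 + N / M.+1%:R.
  apply: win => j jr; rewrite scoreS (negbTE (jr : val j != val (r t.+1))) addr0.
  rewrite /score addrAC lerD2r -mulrDr ler_pM2l //.
  have /andP[+ _] := vu j; have /andP[_ +] := vu' j.
  by rewrite (vv' _ jr) -(natr1 (v' j)) mulrDl mul1r => /le_trans + ?; apply; rewrite lerD2r.
have /andP[_ ua] := vu (r t.+1); have /andP[bu' _] := vu' (r t.+1).
rewrite /score addrAC [X in _ <= X]addrAC -addrA addrAC lerD2r addrA => win.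
have {win} := grid_shift N_gt0 M0 bu' _ win.
rewrite -(natr1 (v _)) in ua => /(_ _ ua); move: (v _) (v' _) => a b Nab.
rewrite -leq_subLR truncn_ge_nat; last by rewrite addr_ge0 // divr_ge0 // ltW.
have [|/ltnW le_ab] := leqP b a.
  by rewrite -subn_eq0 => /eqP ->; rewrite addr_ge0 // divr_ge0 // ltW.
rewrite natrB // -(ler_pM2l N_gt0) !mulrDr mulrN mulrCA mulfV ?gt_eqF // mulr1.
lra.
Qed.

End Stability.

(** * Probability of an entry and expected cost *)

(** The integral of a nonnegative function is a supremum over simple functions below it, so no
    measurability is required. Hence the cost can be compared with a measurable majorant without
    being shown measurable itself. *)
Lemma le_integral_ge0 d (Omega : measurableType d) (R : realType)
    (mu : {measure set Omega -> \bar R}) (f g : Omega -> \bar R) :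
  (forall w, 0 <= f w)%E -> (forall w, f w <= g w)%E ->
  (\int[mu]_w f w <= \int[mu]_w g w)%E.
Proof.
move=> f0 fg; have g0 w : (0 <= g w)%E by exact: le_trans (f0 w) (fg w).
rewrite !ge0_integralTE //; apply: le_ereal_sup => _ [h hf <-].
by exists h => // w; exact: le_trans (hf w) (fg w).
Qed.

Lemma uniform01_itv (R : realType) (a b : R) : 0 <= a -> a <= b -> b <= 1 ->
  uniform_prob (@ltr01 R) `[a, b]%classic = (b - a)%:E.
Proof.
move=> a0 ab b1; rewrite /uniform_prob.
rewrite (eq_integral (fun=> 1%E)) => [|x]; last first.
  rewrite inE /= in_itv /= => /andP[ax xb].
  by rewrite /uniform_pdf (le_trans a0 ax) (le_trans xb b1) /= subr0 invr1.
rewrite integral_cst //= mul1e lebesgue_measure_itv /= lte_fin.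
case: ltP => [//|ba]; have -> : b = a by apply/eqP; rewrite eq_le ab ba.
by rewrite subrr.
Qed.

Section Expectation.
Variables (R : realType) (d : measure_display) (Omega : measurableType d).
Variables (P : probability Omega R) (U : nat -> {RV P >-> R}).
Hypothesis iidU : iid_uniform U.
Variables (N : R) (n k M : nat) (r : nat -> 'I_n).
Hypotheses (N_gt0 : 0 < N) (kn : (k <= n)%N) (NM : N <= M.+1%:R).
Local Notation u w := (fun j => U j w).

(** Samples are indexed by nat but v by pages; [r 0] is only a default for indices j >= n. *)
Definition cell_side (v : {ffun 'I_n -> 'I_M.+1}) (j : nat) : set R :=
  let c := v (insubd (r 0) j) in `[c%:R / M.+1%:R, c.+1%:R / M.+1%:R]%classic.

Definition cell (v : {ffun 'I_n -> 'I_M.+1}) : set Omega :=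
  (\bigcap_(j in [set` iota 0 n]) (U j @^-1` cell_side v j))%classic.

Lemma cellP v w : cell v w <-> in_cell v (u w).
Proof.
split=> [vw j|vw j].
  have := vw j; rewrite /= /cell_side /= valKd in_itv /=; apply.
  by rewrite mem_iota /= ltn_ord.
rewrite /= mem_iota add0n /= /cell_side /= in_itv /= => jn.
by have := vw (insubd (r 0) j); rewrite insubdK.
Qed.

Lemma measurable_cell v : measurable (cell v).
Proof.
apply: fin_bigcap_measurable; first exact: finite_seq.
move=> j _; rewrite -[X in measurable X]setTI; apply: measurable_funP => //.
exact: measurable_itv.
Qed.

Lemma prob_cell v : P (cell v) = (M.+1%:R^-1 ^+ n)%:E.
Proof.
rewrite /cell (iid_uniform_indep iidU) ?iota_uniq //; last first.
  by move=> j; exact: measurable_itv.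
rewrite -[in RHS](size_iota 0 n); elim: (iota 0 n) => [|j J IH].
  by rewrite big_nil expr0.
rewrite big_cons {}IH exprS EFinM; congr (_ * _)%E.
have M0 : 0 < M.+1%:R :> R by rewrite ltr0n.
rewrite (iid_uniform_law iidU); last exact: measurable_itv.
rewrite /cell_side uniform01_itv.
- by rewrite -mulrBl -natrB // subSnn mul1r.
- by rewrite divr_ge0 ?ler0n.
- by rewrite ler_pM2r ?invr_gt0 // ler_nat.
- by rewrite ler_pdivrMr // mul1r ler_nat.
Qed.

(** The samples lie in some grid cell, and if a page enters, that cell belongs to [entry_cells] by
    definition. *)
Lemma enters_le_cells t w :
  ((enters N k (u w) r t)%:R <=
    \sum_(v <- enum (entry_cells N k M r t)) \1_(cell v) w :> R).
Proof.
case ent: enters; last by apply: sumr_ge0 => v _; rewrite indicE ler0n.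
have [v vw] : exists v : {ffun 'I_n -> 'I_M.+1}, in_cell v (u w).
  have /fin_all_exists[c cP] (j : 'I_n) := grid_cell M (iid_uniform_range iidU j w).
  by exists [ffun j => c j] => j; rewrite ffunE.
rewrite big_enum (bigD1 v) /=; last by rewrite inE; apply/asboolP; exists (u w).
rewrite indicE mem_set; last exact/cellP.
by rewrite lerDl; apply: sumr_ge0 => v' _; rewrite indicE ler0n.
Qed.

Lemma prob_entry_cells t : (0 < t)%N ->
  (\sum_(v <- enum (entry_cells N k M r t)) P (cell v) <= (4 / N)%:E)%E.
Proof.
move=> t0; rewrite big_enum (eq_bigr _ (fun v _ => prob_cell v)) sumEFin lee_fin.
rewrite sumr_const -[leLHS]mulr_natl.
have M0 : 0 < M.+1%:R :> R by rewrite ltr0n.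
have := card_spread_ffun (fun v v' =>
  @entry_cells_spread R N n k M r N_gt0 t v v' t0).
set m := Num.truncn _; rewrite -(ler_nat R) natrM natrX => le_card.
have le_m : m.+1%:R <= 3 + M.+1%:R / N.
  have : m%:R <= 2 + M.+1%:R / N by rewrite truncn_le addr_ge0 // divr_ge0 // ltW.
  by rewrite -(natr1 m); lra.
have n0 : (0 < n)%N by apply: leq_ltn_trans (ltn_ord (r 0)).
rewrite exprVn ler_pdivrMr ?exprn_gt0 //; apply: le_trans le_card _.
rewrite -[in leRHS](prednK n0) exprS mulrA ler_pM2r ?exprn_gt0 //.
apply: le_trans le_m _; rewrite mulrAC -mulrA [in leRHS]mulrC.
(* The grid is fine enough (N <= M+1) for the rounding term 3 to be absorbed: 3 + (M+1)/N <=
   4(M+1)/N. *)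
have : 1 <= M.+1%:R / N by rewrite ler_pdivlMr // mul1r.
lra.
Qed.

Lemma expectation_leader_cost T (D : {set 'I_n}) : #|D| = k ->
  ('E_P [fun w => (total_cost T r (leader N k (u w) r))%:R] <=
   ((\sum_(1 <= t < T.+1) loss (r t) D)%:R + 2 * k%:R * N + T%:R * (4 / N))%:E)%E.
Proof.
move=> Dk; rewrite unlock.
pose B := (\sum_(1 <= t < T.+1) loss (r t) D)%:R + 2 * k%:R * N.
have B0 : 0 <= B by rewrite addr_ge0 // !mulr_ge0 // ltW.
pose g t w : \bar R := (\sum_(v <- enum (entry_cells N k M r t)) (\1_(cell v) w)%:E)%E.
have g0 t w : (0 <= g t w)%E.
  by apply: sume_ge0 => v _; rewrite lee_fin indicE ler0n.
have m_ind v : measurable_fun setT (EFin \o (\1_(cell v) : Omega -> R)).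
  by apply/measurable_EFinP/measurable_indic/measurable_cell.
have mg t : measurable_fun setT (g t) by apply: emeasurable_sum => v; exact: m_ind.
apply: (@le_trans _ _ (\int[P]_w (B%:E + \sum_(2 <= t < T.+1) g t w))%E).
  apply: le_integral_ge0 => w; first by rewrite lee_fin ler0n.
  have := leader_cost (ltW N_gt0) kn r (fun j => iid_uniform_range iidU j w) T Dk.
  rewrite -lee_fin => /le_trans; apply; rewrite EFinD leeD2l // -sumEFin.
  rewrite big_nat [leRHS]big_nat; apply: lee_sum => t _.
  by rewrite /g sumEFin lee_fin; exact: enters_le_cells.
rewrite ge0_integralD //=; last 2 first.
- by move=> w _; apply: sume_ge0.
- by apply: emeasurable_sum => t; exact: mg.
rewrite integral_cst //= probability_setT mule1 -/B [leRHS]EFinD; apply: leeD2l.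
rewrite ge0_integral_sum //.
apply: (@le_trans _ _ (\sum_(2 <= t < T.+1) (4 / N)%:E)%E).
  rewrite big_nat [leRHS]big_nat; apply: lee_sum => t /andP[t2 _].
  rewrite /g ge0_integral_sum //.
  rewrite (eq_bigr (fun v => P (cell v))); first exact/prob_entry_cells/ltnW.
  by move=> v _; rewrite integral_indic ?setIT //; exact: measurable_cell.
rewrite sumEFin lee_fin sumr_const_nat -[leLHS]mulr_natl.
apply: ler_wpM2r; first by rewrite divr_ge0 // ltW.
by rewrite ler_nat; lia.
Qed.

End Expectation.

(** * Choice of the noise scale and the final constants *)

Lemma total_cost_full n T (r : nat -> 'I_n) (C : nat -> {set 'I_n}) :
  (forall t, (1 <= t <= T)%N -> #|C t| = n) -> total_cost T r C = 0%N.
Proof.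
move=> Cn; have CT t : (1 <= t <= T)%N -> C t = [set: 'I_n]%SET.
  by move=> tT; apply/eqP; rewrite eqEcard finset.subsetT cardsT card_ord Cn // leqnn.
rewrite /total_cost big_nat big1 => [|t tT]; last by rewrite /loss CT ?finset.in_setT.
rewrite add0n big_nat big1 // => t tT.
by rewrite /cache_dist !CT ?finset.setDv ?cards0 //; lia.
Qed.

Lemma le_best_fixed_cost (R : realType) n k T (r : nat -> 'I_n) (x : \bar R) (rho : R) :
  (forall D : {set 'I_n}, #|D| = k ->
     (x <= ((\sum_(1 <= t < T.+1) loss (r t) D)%:R + rho)%:E)%E) ->
  (x <= best_fixed_cost R k T r + rho%:E)%E.
Proof.
move=> le_D; rewrite /best_fixed_cost.
elim/big_ind: _ => [|y z xy xz|D /eqP Dk]; first by rewrite addye ?leey.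
  by rewrite /Order.min; case: ifP.
by rewrite -EFinD; exact: le_D.
Qed.

Lemma ln_ge_quarter (R : realType) n : (2 <= n)%N -> 4^-1 <= ln (n%:R : R).
Proof.
move=> n2; have ln_half : ln (2^-1 : R) <= - 2^-1.
  rewrite [X in ln X](_ : _ = 1 + (- 2^-1)); last by lra.
  by apply: le_ln1Dx; lra.
have : ln (2 : R) <= ln (n%:R : R).
  by rewrite ler_ln ?posrE ?ltr0n ?ler_nat //; lia.
by move: ln_half; rewrite lnV ?posrE //; lra.
Qed.

Lemma noise_scale_sqrt (R : realType) (k T : nat) : (0 < k)%N -> (0 < T)%N ->
  [/\ 0 < noise_scale R k T,
      k%:R * noise_scale R k T = Num.sqrt (k%:R * T%:R) &
      T%:R / noise_scale R k T = Num.sqrt (k%:R * T%:R)].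
Proof.
move=> k0 T0; have k0R : 0 < k%:R :> R by rewrite ltr0n.
have T0R : 0 < T%:R :> R by rewrite ltr0n.
rewrite /noise_scale mul1r powR12_sqrt; last by rewrite divr_ge0 // ltW.
have N0 : 0 < Num.sqrt (T%:R / k%:R) :> R by rewrite sqrtr_gt0 divr_gt0.
have kN : k%:R * Num.sqrt (T%:R / k%:R) = Num.sqrt (k%:R * T%:R) :> R.
  apply/eqP; rewrite -(eqrXn2 (n := 2)) // ?mulr_ge0 ?sqrtr_ge0 ?(ltW k0R) //.
  rewrite exprMn !sqr_sqrtr ?mulr_ge0 ?divr_ge0 ?(ltW k0R) ?(ltW T0R) //.
  by apply/eqP; field; rewrite gt_eqF.
split => //; rewrite -kN; apply: (mulIf (lt0r_neq0 N0)).
rewrite divfK ?gt_eqF // -mulrA -expr2 sqr_sqrtr ?divr_ge0 ?(ltW k0R) ?(ltW T0R) //.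
by rewrite mulrC divfK ?gt_eqF.
Qed.

Lemma eq_total_cost n T (r : nat -> 'I_n) (C C' : nat -> {set 'I_n}) :
  (forall t, (0 < t)%N -> C t = C' t) -> total_cost T r C = total_cost T r C'.
Proof.
move=> CC'; rewrite /total_cost; congr (_ + _)%N; apply: eq_big_nat => t /andP[t1 _].
  by rewrite CC'.
by rewrite !CC' //; lia.
Qed.

Lemma round_time_poly (R : realType) (n T c : nat) : (0 < n)%N -> (0 < T)%N ->
  (42 <= c)%N -> (round_time n)%:R <= c%:R * (n%:R + ln T%:R) ^+ c :> R.
Proof.
move=> n0 T0 c42; have lnT : 0 <= ln (T%:R : R) by rewrite ln_ge0 // (ler_nat R 1).
have le_round : (round_time n <= c * n ^ c)%N.
  apply: (@leq_trans (c * n ^ 2)).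
    (* [round_time] is 6n^2 + 16n + 20, and 6 + 16 + 20 = 42. *)
    by rewrite /round_time expnS expn1; nia.
  by rewrite leq_mul2l leq_pexp2l ?orbT // (leq_trans _ c42).
rewrite -(ler_nat R) in le_round; apply: le_trans le_round _.
rewrite natrM natrX ler_wpM2l ?ler0n // lerXn2r ?nnegrE ?ler0n ?addr_ge0 //.
by rewrite lerDl.
Qed.

Lemma expected_cost_bound (R : realType) d (Omega : measurableType d)
    (P : probability Omega R) (U : nat -> {RV P >-> R}) (n k T : nat)
    (r : nat -> 'I_n) (D : {set 'I_n}) :
  iid_uniform U -> (1 <= k <= n)%N -> (1 <= T)%N -> #|D| = k ->
  (expected_cost U paging_program k T (round_time n) r <=
    ((\sum_(1 <= t < T.+1) loss (r t) D)%:R + 6 * Num.sqrt (k%:R * T%:R))%:E)%E.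
Proof.
move=> iidU /andP[k1 kn] T1 Dk; have [N0 kN TN] := noise_scale_sqrt R k1 T1.
have NM : noise_scale R k T <= (Num.bound (noise_scale R k T)).+1%:R.
  by apply: le_trans (ltW (archi_boundP (ltW N0))) _; rewrite ler_nat.
have -> : expected_cost U paging_program k T (round_time n) r = ('E_P [fun w =>
    (total_cost T r (leader (noise_scale R k T) k (fun j => U j w) r))%:R])%E.
  congr (expectation P _); apply/funext => w; congr (_%:R).
  by apply: eq_total_cost => t t0; exact: cache_at_leader.
apply: le_trans (expectation_leader_cost iidU r N0 kn NM T Dk) _.
rewrite lee_fin -addrA lerD2l -mulrA kN mulrCA TN; lra.
Qed.

Lemma card_cache_at (R : realType) n k T (u : nat -> R) (r : nat -> 'I_n) t :
  (k <= n)%N -> (0 < t)%N -> #|cache_at paging_program k T (round_time n) u r t| = k.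
Proof. by move=> kn t0; rewrite cache_at_leader // card_topk. Qed.

Unset Implicit Arguments.
Set Strict Implicit.
Set Printing Implicit Defensive.

Theorem theorem2p6 (R : realType) :
  exists C : R, 0 < C /\
  exists (p : cmd) (c : nat) (tau : nat -> nat -> nat -> nat),
  forall n k T : nat, (1 <= k <= n)%N -> (1 <= T)%N ->
    [/\ (tau n k T)%:R <= c%:R * (n%:R + ln T%:R) ^+ c :> R,
        paging_algorithm R p n k T (tau n k T) &
        forall (d : measure_display) (Omega : measurableType d)
               (P : probability Omega R) (U : nat -> {RV P >-> R}),
          iid_uniform U ->
          (regret U p n k T (tau n k T) <=
             (C * Num.sqrt (k%:R * T%:R * ln n%:R))%:E)%E].
Proof.
(* 12 is 6 divided by the lower bound 1/2 on sqrt(ln n) for n >= 2. *)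
exists 12%:R; split; first by rewrite ltr0n.
exists paging_program, 42%N, (fun n _ _ => round_time n) => n k T /[dup] kn /andP[k1 k_n] T1.
split=> [|u r _ t /andP[t0 _]|d Omega P U iidU].
- by apply: round_time_poly => //; exact: leq_trans k1 k_n.
- by split; [exact: round_terminates_within | exact: card_cache_at].
apply: ereal_inf_lbound => /=; exists (12%:R * Num.sqrt (k%:R * T%:R * ln n%:R)) => //= r.
apply: le_best_fixed_cost => D Dk.
(* For n = 1 the claimed bound is 0 because ln 1 = 0. Then k = n, so the cache always holds every
   page and nothing is ever paid. *)
have [n1|n2] := leqP n 1.
  have n_1 : n = 1%N by lia.
  rewrite /expected_cost unlock; set f := fun w => _.
  have -> : f = cst 0.
    apply/funext => w; rewrite /f total_cost_full // => t /andP[t0 _].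
    by rewrite card_cache_at //; lia.
  by rewrite integral_cst // mul0e lee_fin addr_ge0 // mulr_ge0 // sqrtr_ge0.
apply: le_trans (expected_cost_bound r iidU kn T1 Dk) _.
rewrite lee_fin lerD2l [Num.sqrt (_ * ln _)]sqrtrM ?mulr_ge0 // mulrA.
have half : 2^-1 <= Num.sqrt (ln (n%:R : R)).
  rewrite -(ger0_norm (_ : 0 <= 2^-1 :> R)) // -sqrtr_sqr ler_wsqrtr //.
  by apply: le_trans (ln_ge_quarter R n2); lra.
have := ler_wpM2l (sqrtr_ge0 (k%:R * T%:R : R)) half; lra.
Qed.
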